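(* There exists a universal numerical constant $C>0$ such that the following holds. Let $n\ge2$, $A\ge1$, let $\theta=(\theta_0,\dots,\theta_{n-1})\in[0,A]^n$ be nonincreasing, let $\Pi^*$ be an $n\times n$ permutation matrix, $X=\Pi^*\cdot T(\theta)$, and $Y=X+E$, where the entries of $E$ are independent $\mathcal N(0,1)$ variables. Let $\mathcal A=[0,A]\cap(n^{-2}\mathbb N)$ and let $\hat\Pi^{(\mathrm{LS},\mathrm T)}$ be a minimizer over all permutation matrices $\Pi$ of $$\inf_{\tilde\theta\in\mathcal A^n\ \text{nonincreasing}}\|\Pi\cdot Y-T(\tilde\theta)\|_F^2.$$ Then $$\mathbb E\big[\ell_2(\hat\Pi^{(\mathrm{LS},\mathrm T)})\big]\le C\Big(\sqrt{n\log(nA)}+A/n\Big).$$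
   Context: $\mathbb N$ includes $0$. $T(\theta)$ is the $n\times n$ Toeplitz matrix with $T(\theta)_{i,j}=\theta_{|i-j|}$. For a permutation matrix $\Pi$, $\Pi\cdot M:=\Pi M\Pi^\top$. A symmetric matrix $R\in\mathbb R^{n\times n}$ is Robinson if $R_{i,1}\le\dots\le R_{i,i}\ge\dots\ge R_{i,n}$ for each $i$; $\mathcal R_n$ is the set of such matrices, and $\ell_2(\Pi)=\inf_{R\in\mathcal R_n}\|\Pi\cdot X-R\|_F$, with $\|\cdot\|_F$ the Frobenius norm. *)

(* Defs.v *)
From HB Require Import structures.
From mathcomp Require Import all_boot all_order all_algebra.
From mathcomp Require Import all_classical all_reals all_analysis.

Set Implicit Arguments.
Unset Strict Implicit.
Unset Printing Implicit Defensive.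

Import Order.TTheory GRing.Theory Num.Theory.
Import numFieldNormedType.Exports.

Local Open Scope classical_set_scope.
Local Open Scope ring_scope.

Lemma ltn_distn_ord (n : nat) (i j : 'I_n) : (`|i - j| < n)%N.
Proof.
have [le_ji | /ltnW le_ij] := leqP j i.
  by rewrite distnEl // (leq_ltn_trans (leq_subr _ _)).
by rewrite distnEr // (leq_ltn_trans (leq_subr _ _)).
Qed.

Definition dist_ord (n : nat) (i j : 'I_n) : 'I_n :=
  Ordinal (ltn_distn_ord i j).

Definition toeplitz (R : realType) (n : nat) (theta : 'rV[R]_n) : 'M[R]_n :=
  \matrix_(i, j) theta 0 (dist_ord i j).

Definition mxact (R : realType) (n : nat) (Pi M : 'M[R]_n) : 'M[R]_n :=
  Pi *m M *m Pi^T.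

Definition frobenius_norm (R : realType) (m n : nat) (M : 'M[R]_(m, n)) : R :=
  Num.sqrt (\sum_i \sum_j M i j ^+ 2).

Definition robinson (R : realType) (n : nat) : set 'M[R]_n :=
  [set M | M^T = M
    /\ forall i : 'I_n,
         (forall j k : 'I_n, (j <= k)%N -> (k <= i)%N -> M i j <= M i k)
      /\ (forall j k : 'I_n, (i <= j)%N -> (j <= k)%N -> M i k <= M i j)].

(* The zero matrix is Robinson and norms are nonnegative, so [inf] is a genuine
   infimum here (it is junk on empty or unbounded-below sets). *)
Definition l2_loss (R : realType) (n : nat) (X Pi : 'M[R]_n) : R :=
  inf [set frobenius_norm (mxact Pi X - M) | M in @robinson R n].

Definition nonincreasing_vec (R : realType) (n : nat) (theta : 'rV[R]_n) :=
  forall i j : 'I_n, (i <= j)%N -> theta 0 j <= theta 0 i.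

Definition grid (R : realType) (n : nat) (A : R) : set R :=
  [set x | 0 <= x <= A /\ exists k : nat, x = (n%:R ^+ 2)^-1 * k%:R].

(* For 0 <= A the zero vector is admissible, so [inf] is again genuine. *)
Definition ls_criterion (R : realType) (n : nat) (A : R) (Y Pi : 'M[R]_n) : R :=
  inf [set frobenius_norm (mxact Pi Y - toeplitz theta) ^+ 2 | theta in
        [set theta : 'rV[R]_n | (forall i, grid n A (theta 0 i))
                                /\ nonincreasing_vec theta]].

Definition ls_minimizer (R : realType) (n : nat) (A : R) (Y Pi : 'M[R]_n) :=
  is_perm_mx Pi /\
  forall Pi' : 'M[R]_n, is_perm_mx Pi' ->
    ls_criterion A Y Pi <= ls_criterion A Y Pi'.

Definition mutually_independent (R : realType) (d : measure_display)
    (Omega : measurableType d) (P : probability Omega R) (I : finType)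
    (X : I -> {RV P >-> R}) :=
  forall (J : {set I}) (B : I -> set R), (forall i, measurable (B i)) ->
    P [set w | forall i, i \in J -> B i (X i w)]
    = (\prod_(i in J) P (X i @^-1` B i))%E.

(* The second parameter of [normal_prob] is the standard deviation. *)
Definition standard_normal (R : realType) (d : measure_display)
    (Omega : measurableType d) (P : probability Omega R) (X : {RV P >-> R}) :=
  forall B : set R, measurable B ->
    distribution P X B = normal_prob (0 : R) 1 B.

(* Main.v *)
Require Import Defs.
From HB Require Import structures.
From mathcomp Require Import all_boot all_order all_algebra.
From mathcomp Require Import all_classical all_reals all_analysis.
From mathcomp Require Import all_fingroup measurable_realfun zify ring lra.

Set Implicit Arguments.
Unset Strict Implicit.
Unset Printing Implicit Defensive.

Import Order.TTheory GRing.Theory Num.Theory.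
Import numFieldNormedType.Exports.

Local Open Scope classical_set_scope.
Local Open Scope ring_scope.

(** Let [theta0] be [theta] rounded down to the grid, [X0] the corresponding
    permuted Toeplitz matrix, so that [|X - X0| <= 1/n], and let [Xh] be the
    permuted Toeplitz matrix fitted by the estimator. Comparing the criterion at
    the estimator and at the truth gives
    [|X - Xh|^2 <= 2/n^2 + 2 <E, Xh - X0>], hence
    [|X - Xh| <= 2/n + 4 max(0, <E, u>)] where [u] is [Xh - X0] normalized. Since
    Toeplitz matrices of nonincreasing vectors are Robinson, the left-hand side
    dominates the loss. Now [u] ranges over a finite family, indexed by a
    permutation and a vector of grid points, of at most [(nA)^(5n)] elements, and
    each [<E, u>] is sub-Gaussian, so a Chernoff bound on the maximum gives the
    order [sqrt (n log (nA))]. *)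

(** * Weighted image measures and products of independent variables *)

Section IntegralDensity.
Import HBNNSimple.

(** The hypothesis on indicators says that the measure with density [W] has image [c * nu] under
    [phi]; simple functions and monotone convergence extend it to [f]. It serves both to split off
    one independent factor and to pass from a Gaussian law to its density. *)
Lemma ge0_integral_density (R : realType) (d d' : measure_display)
    (T : measurableType d) (T' : measurableType d')
    (mu : {measure set T -> \bar R}) (nu : {measure set T' -> \bar R})
    (W : T -> R) (phi : T -> T') (c : R) (f : T' -> R) :
  measurable_fun [set: T] W -> (forall x, 0 <= W x) ->
  measurable_fun [set: T] phi -> 0 <= c ->
  (forall B : set T', measurable B ->
    \int[mu]_x (W x * \1_B (phi x))%:E = c%:E * nu B)%E ->
  measurable_fun [set: T'] f -> (forall y, 0 <= f y) ->
  (\int[mu]_x (W x * f (phi x))%:E = c%:E * \int[nu]_y (f y)%:E)%E.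
Proof.
move=> mW W0 mphi c0 H mf f0.
pose F (y : T') : \bar R := (f y)%:E.
have mF : measurable_fun [set: T'] F by exact/measurable_EFinP.
have F0 y : (0 <= F y)%E by rewrite lee_fin.
pose f_ := nnsfun_approx measurableT mF.
have mWg (g : T' -> R) : measurable_fun setT g ->
    measurable_fun [set: T] (fun x => (W x * g (phi x))%:E).
  by move=> mg; apply/measurable_EFinP/measurable_funM => //; exact: measurableT_comp.
have simple n : (\int[mu]_x (W x * f_ n (phi x))%:E
    = c%:E * \int[nu]_y (f_ n y)%:E)%E.
  (* True even for negative [r]: the indicator vanishes unless [r] is a value of [f_ n], and those
     are nonnegative. *)
  have r0 r x : 0 <= r * \1_(f_ n @^-1` [set r]) x.
    rewrite indicE; case: (boolP (x \in _)) => [/set_mem <-|_];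
    by rewrite ?mulr1 ?mulr0.
  rewrite (eq_integral (fun x => \sum_(r \in range (f_ n))
      (W x * (r * \1_(f_ n @^-1` [set r]) (phi x)))%:E)%E); last first.
    move=> x _; rewrite [in LHS](fimfunE (f_ n)) EFinM -fsumEFin//.
    by rewrite ge0_mule_fsumr// => r; rewrite lee_fin.
  rewrite ge0_integral_fsum//; last 2 first.
  - by move=> r; apply: (mWg (fun y => r * \1_(f_ n @^-1` [set r]) y)); exact: measurable_funM.
  - by move=> r x _; rewrite lee_fin mulr_ge0.
  rewrite integralT_nnsfun sintegralE ge0_mule_fsumr//; last first.
    by move=> i; exact: nnsfun_mulemu_ge0.
  apply: eq_fsbigr => r /set_mem[y _ yr].
  rewrite muleCA -H// -ge0_integralZl//.
  - by apply: eq_integral => x _; rewrite -EFinM mulrCA.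
  - exact: (mWg (\1_(f_ n @^-1` [set r]))).
  - by move=> x _; rewrite lee_fin mulr_ge0.
  - by rewrite lee_fin -yr.
have cvg1 : (\int[mu]_x (W x * f_ n (phi x))%:E @[n --> \oo]
     --> \int[mu]_x (W x * f (phi x))%:E)%E.
  have -> : (\int[mu]_x (W x * f (phi x))%:E
      = \int[mu]_x limn (fun n => (W x * f_ n (phi x))%:E))%E.
    apply: eq_integral => x _; apply/esym/cvg_lim => //.
    under eq_fun do rewrite EFinM.
    by rewrite EFinM; apply: cvgeZl => //; exact: (cvg_nnsfun_approx measurableT).
  apply: cvg_monotone_convergence => //.
  - by move=> n; exact: (mWg (f_ n)).
  - by move=> n x _; rewrite lee_fin mulr_ge0.
  - by move=> x _ m n mn; rewrite lee_fin ler_wpM2l//; exact/lefP/nd_nnsfun_approx.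
have cvg2 : (c%:E * \int[nu]_y (f_ n y)%:E @[n --> \oo]
     --> c%:E * \int[nu]_y (f y)%:E)%E.
  apply: cvgeZl => //.
  have -> : (\int[nu]_y (f y)%:E = \int[nu]_x limn (fun n => (f_ n x)%:E))%E.
    apply: eq_integral => x _; apply/esym/cvg_lim => //.
    exact: (cvg_nnsfun_approx measurableT).
  apply: cvg_monotone_convergence => //.
  - by move=> n; exact/measurable_EFinP.
  - by move=> n x _; rewrite lee_fin.
  - by move=> x _ m n mn; rewrite lee_fin; exact/lefP/nd_nnsfun_approx.
move: cvg1; under eq_fun do rewrite simple.
by move=> cvg1; exact: (cvg_unique _ cvg1 cvg2).
Qed.

End IntegralDensity.

Lemma mutually_independent_prod (R : realType) (d : measure_display)
    (Omega : measurableType d) (P : probability Omega R) (I : finType)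
    (X : I -> {RV P >-> R}) (f : I -> R -> R) (m : I -> R) :
  mutually_independent X ->
  (forall i, measurable_fun [set: R] (f i)) -> (forall i y, 0 <= f i y) ->
  (forall i, (\int[P]_w (f i (X i w))%:E = (m i)%:E)%E) ->
  (\int[P]_w (\prod_i f i (X i w))%:E = (\prod_i m i)%:E)%E.
Proof.
(* One factor at a time, the [g i] pass from indicators, for which the claim is
   the definition of independence, to general nonnegative functions. *)
move=> indX; suff H (s : seq I) (g : I -> R -> R) (c : I -> R) :
    (forall i, measurable_fun [set: R] (g i)) -> (forall i y, 0 <= g i y) ->
    (forall i, (\int[P]_w (g i (X i w))%:E = (c i)%:E)%E) ->
    (forall i, i \notin s -> exists B, measurable B /\ g i = \1_B) ->
    (\int[P]_w (\prod_i g i (X i w))%:E = (\prod_i c i)%:E)%E.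
  move=> mf f0 fm; apply: (H (enum I)) => // i.
  by rewrite mem_enum.
have mX i (B : set R) : measurable B -> measurable (X i @^-1` B).
  by move=> mB; rewrite -[X in measurable X]setTI; exact: measurable_funP.
have indicT (B : set Omega) : measurable B ->
    (\int[P]_w (\1_B w)%:E = P B)%E.
  by move=> mB; rewrite integral_indic// setIT.
elim: s g c => [|k s IH] g c mg g0 gc ind.
  have /choice[B HB] : forall i, exists B : set R, measurable B /\ g i = \1_B.
    by move=> i; exact: ind.
  have gE i : g i = \1_(B i) by case: (HB i).
  have mB i : measurable (B i) by case: (HB i).
  have cE i : (c i)%:E = P (X i @^-1` B i).
    by rewrite -gc gE -(indicT _ (mX i _ (mB i))).
  pose J : {set I} := [set: I]%SET.
  have := indX J B mB.
  rewrite (eq_bigr (fun i => (c i)%:E)) => [|i _]; last by rewrite cE.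
  rewrite prodEFin (eq_bigl xpredT) => [<-|i]; last by rewrite inE.
  rewrite -indicT; last first.
    rewrite (_ : [set _ | _] = \bigcap_(i in [set: I]) (X i @^-1` B i)).
      by apply: fin_bigcap_measurable => // i _; exact: mX.
    apply/seteqP; split => w /= h i; first by move=> _; apply: h; rewrite inE.
    by move=> _; exact: h.
  apply: eq_integral => w _; congr EFin.
  rewrite indicE; have [/set_mem /= h|h] := boolP (w \in _).
    rewrite big1// => i _; rewrite gE indicE mem_set//.
    by apply: h; rewrite inE.
  have [i hi] : exists i, ~ B i (X i w).
    by apply/existsNP => h'; move: h; rewrite notin_setE; apply => i _.
  by rewrite (bigD1 i)//= gE indicE memNset// mul0r.
have c0 i : 0 <= c i.
  by rewrite -lee_fin -gc; apply: integral_ge0 => w _; rewrite lee_fin.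
rewrite (bigD1 k)//= mulrC EFinM -gc.
rewrite -(@ge0_integral_distribution _ _ _ _ _ P (X k) (fun y => (g k y)%:E))//; last 2 first.
- exact/measurable_EFinP.
- by move=> y; rewrite lee_fin.
(* The remaining factors form the weight, so [g k] only has to be tested on indicators [\1_B]. That
   test is [IH] with [g k] replaced by [\1_B]. *)
rewrite -(@ge0_integral_density _ _ _ _ _ P _
  (fun w => \prod_(i | i != k) g i (X i w)) (X k))//.
- by apply: eq_integral => w _; rewrite (bigD1 k)//= mulrC.
- under eq_fun do rewrite -big_filter.
  by apply: measurable_prod => i _; exact: measurableT_comp.
- by move=> w; apply: prodr_ge0.
- by apply: prodr_ge0.
move=> B mB.
have PB : P (X k @^-1` B) \is a fin_num by apply: fin_num_measure; exact: mX.
have := IH (fun i => if i == k then \1_B else g i)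
  (fun i => if i == k then fine (P (X k @^-1` B)) else c i).
rewrite (bigD1 k)//= eqxx (eq_bigr c) => [|i /negbTE->//].
rewrite EFinM fineK// muleC => <-.
- apply: eq_integral => w _; congr EFin.
  rewrite [RHS](bigD1 k)//= eqxx mulrC; congr (_ * _).
  by apply: eq_bigr => i /negbTE->.
- by move=> i; case: ifP.
- by move=> i y; case: ifP.
- move=> i; case: ifP => [/eqP->|//].
  by rewrite fineK// -(indicT _ (mX k _ mB)).
- move=> i nis; case: ifP => [_|ik]; first by exists B.
  by apply: ind; rewrite inE ik.
Qed.

(** * Exponential moments and maxima of Gaussian linear forms *)

(** Completing the square turns [expR (t * x)] times the standard density into [expR (t ^+ 2 / 2)]
    times the density with mean [t], which integrates to 1. *)
Lemma standard_normal_mgf (R : realType) (d : measure_display)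
    (Omega : measurableType d) (P : probability Omega R)
    (X : {RV P >-> R}) (t : R) :
  standard_normal X ->
  (\int[P]_w (expR (t * X w))%:E = (expR (t ^+ 2 / 2))%:E)%E.
Proof.
move=> nX.
have mexp : measurable_fun [set: R] (fun y => expR (t * y)).
  by apply: measurableT_comp => //; exact: measurable_funM.
rewrite -(@ge0_integral_distribution _ _ _ _ _ P X (fun y => (expR (t * y))%:E))//;
  last exact/measurable_EFinP.
(* This factor is the constant [c] of [ge0_integral_density], used with the Gaussian density as
   weight and the identity as map. *)
rewrite -[LHS]mul1e.
rewrite -(@ge0_integral_density _ _ _ _ _ lebesgue_measure _
  (normal_pdf 0 1) (id : measurableTypeR R -> R) 1)//.
- transitivity (\int[lebesgue_measure]_x
      ((expR (t ^+ 2 / 2))%:E * (normal_pdf t 1 x)%:E))%E.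
    apply: eq_integral => x _; congr EFin.
    rewrite !normal_pdfE// mulrCA -mulrA /normal_fun -!expRD; congr (_ * expR _).
    by field.
  rewrite ge0_integralZl//.
  + by rewrite integral_normal_pdf mule1.
  + by apply/measurable_EFinP; exact: measurable_normal_pdf.
  + by move=> x _; rewrite lee_fin normal_pdf_ge0.
- exact: measurable_normal_pdf.
- by move=> x; exact: normal_pdf_ge0.
- move=> B mB; rewrite mul1e [RHS](nX B mB) /normal_prob[RHS]integral_mkcond.
  apply: eq_integral => x _; rewrite indicE patchE.
  by case: ifP => _; rewrite ?mulr1 ?mulr0.
Qed.

Lemma standard_normal_mgf_sum (R : realType) (d : measure_display)
    (Omega : measurableType d) (P : probability Omega R) (I : finType)
    (X : I -> {RV P >-> R}) (t : I -> R) :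
  mutually_independent X -> (forall i, standard_normal (X i)) ->
  (\int[P]_w (expR (\sum_i t i * X i w))%:E
    = (expR ((\sum_i t i ^+ 2) / 2))%:E)%E.
Proof.
move=> iX nX.
rewrite (eq_integral (fun w => (\prod_i expR (t i * X i w))%:E)); last first.
  by move=> w _; rewrite expR_sum.
rewrite (@mutually_independent_prod _ _ _ _ _ _ (fun i y => expR (t i * y))
  (fun i => expR (t i ^+ 2 / 2)))//.
- by rewrite -expR_sum mulr_suml.
- by move=> i; apply: measurableT_comp => //; exact: measurable_funM.
- by move=> i; exact: standard_normal_mgf.
Qed.

(** The index [j] may depend on [w], so its exponential is bounded by the sum over all of [J], whose
    mean is computed term by term. *)
Lemma gaussian_maximal_inequality (R : realType) (d : measure_display)
    (Omega : measurableType d) (P : probability Omega R) (I J : finType)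
    (X : I -> {RV P >-> R}) (u : J -> I -> R) (Z : Omega -> R) (b c l : R) :
  mutually_independent X -> (forall i, standard_normal (X i)) ->
  (forall j, \sum_i u j i ^+ 2 <= 1) ->
  1 <= l -> 1 + #|J|%:R <= expR l -> 0 <= b -> 0 <= c ->
  measurable_fun [set: Omega] Z -> (forall w, 0 <= Z w) ->
  (forall w, exists j, Z w <= b + c * Num.max (\sum_i u j i * X i w) 0) ->
  (\int[P]_w (Z w)%:E <= (b + 3 * c * Num.sqrt l)%:E)%E.
Proof.
move=> iX nX u1 l1 Jl b0 c0 mZ Z0 Zle.
pose la := Num.sqrt l.
have l0 : 0 < l by lra.
have la0 : 0 < la by rewrite sqrtr_gt0.
have la2 : la ^+ 2 = l by rewrite sqr_sqrtr// ltW.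
(* Chernoff: [la * m <= a + exp (la * m - a)] for every [a]; this value of [a]
   makes the expectation of the exponential term at most 1. *)
pose a := 3 / 2 * l.
pose k1 := c / la * expR (- a).
pose k0 := b + c / la * a + k1.
pose S j w := \sum_i (la * u j i) * X i w.
have k10 : 0 <= k1 by rewrite mulr_ge0 ?expR_ge0// divr_ge0// ltW.
have k00 : 0 <= k0.
  rewrite addr_ge0// addr_ge0// mulr_ge0//; first by rewrite divr_ge0// ltW.
  by rewrite /a; lra.
have mS j : measurable_fun [set: Omega] (fun w => expR (S j w)).
  by apply: measurableT_comp => //; apply: measurable_sum => i; exact: measurable_funM.
have mkS j : measurable_fun [set: Omega] (fun w => (k1%:E * (expR (S j w))%:E)%E).
  by apply/measurable_EFinP; exact: measurable_funM.
have kS0 j w : (0 <= k1%:E * (expR (S j w))%:E)%E.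
  by rewrite -EFinM lee_fin mulr_ge0 ?expR_ge0.
apply: (@le_trans _ _ (\int[P]_w (k0%:E + \sum_j k1%:E * (expR (S j w))%:E))%E).
  apply: ge0_le_integral => //.
  - by move=> w _; rewrite lee_fin.
  - exact/measurable_EFinP.
  - by apply: emeasurable_funD => //; apply: emeasurable_sum.
  move=> w _; have [j Zj] := Zle w.
  rewrite (eq_bigr (fun j => (k1 * expR (S j w))%:E))// sumEFin -EFinD lee_fin.
  apply: (le_trans Zj); rewrite -mulr_sumr.
  set s := \sum_i _ in Zj *; set m := Num.max s 0.
  have Sj : S j w = la * s.
    by rewrite /S /s mulr_sumr; apply: eq_bigr => i _; rewrite mulrA.
  (* The summand 1 covers the case where the positive part is 0. *)
  have sumS : expR (la * m) <= 1 + \sum_j expR (S j w).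
    have : expR (la * s) <= \sum_j expR (S j w).
      by rewrite (bigD1 j)//= Sj lerDl sumr_ge0// => ? _; exact: expR_ge0.
    rewrite /m; case: (leP s 0) => _; last by lra.
    rewrite mulr0 expR0; have := expR_ge0 (la * s); lra.
  have := expR_ge1Dx (la * m - a); rewrite expRD => h.
  have lam : la * m <= a + expR (- a) * (1 + \sum_j expR (S j w)).
    have := ler_wpM2r (expR_ge0 (- a)) sumS; lra.
  have -> : k0 + k1 * \sum_j0 expR (S j0 w)
    = b + c / la * (a + expR (- a) * (1 + \sum_j expR (S j w))).
    by rewrite /k0 /k1; ring.
  rewrite lerD2l -[X in c * X](mulKf (lt0r_neq0 la0)) mulrA.
  by rewrite ler_wpM2l// divr_ge0// ltW.
rewrite ge0_integralD//; last 2 first.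
- by move=> w _; apply: sume_ge0 => j _.
- by apply: emeasurable_sum.
rewrite integral_cst// [X in (_ * X)%E](probability_setT P) mule1 ge0_integral_sum//.
rewrite (eq_bigr (fun j => (k1 * expR ((\sum_i (la * u j i) ^+ 2) / 2))%:E)); last first.
  move=> j _; rewrite ge0_integralZl//; last exact/measurable_EFinP.
  by rewrite standard_normal_mgf_sum// EFinM.
rewrite sumEFin -EFinD lee_fin.
have {}u1 j : expR ((\sum_i (la * u j i) ^+ 2) / 2) <= expR (l / 2).
  rewrite ler_expR ler_pM2r// (eq_bigr (fun i => l * u j i ^+ 2)).
    by rewrite -mulr_sumr ler_piMr// ltW.
  by move=> i _; rewrite exprMn la2.
apply: (@le_trans _ _ (k0 + \sum_(j : J) k1 * expR (l / 2))).
  by rewrite lerD2l; apply: ler_sum => j _; rewrite ler_wpM2l.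
have -> : \sum_(j : J) k1 * expR (l / 2) = k1 * expR (l / 2) * #|J|%:R.
  by rewrite sumr_const -[LHS]mulr_natr.
rewrite /k0.
have e1 : 1 <= expR (l / 2) by rewrite -[leLHS]expR0 ler_expR; lra.
have ea : expR (- a) * (expR (l / 2) * expR l) = 1.
  by rewrite -!expRD -[RHS]expR0; congr expR; rewrite /a; field.
(* Enlarging 1 to [expR (l / 2)] makes [1 + #|J|] appear as a factor; the hypothesis bounds it by
   [expR l], and [ea] cancels the product. *)
have h1 : expR (- a) * (1 + #|J|%:R * expR (l / 2)) <= 1.
  rewrite -[leRHS]ea ler_wpM2l ?expR_ge0//.
  apply: (@le_trans _ _ (expR (l / 2) * (1 + #|J|%:R))).
    by rewrite mulrDr mulr1 [_ * #|J|%:R]mulrC lerD2r.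
  by rewrite ler_wpM2l// expR_ge0.
have -> : b + c / la * a + k1 + k1 * expR (l / 2) * #|J|%:R
  = b + c / la * (a + expR (- a) * (1 + #|J|%:R * expR (l / 2))).
  by rewrite /k1; ring.
rewrite lerD2l [3 * c]mulrC -!mulrA ler_wpM2l// ler_pdivrMl//.
rewrite mulrCA -expr2 la2.
(* What remains is [3 / 2 * l + 1 <= 3 * l], which holds because [1 <= l]. *)
by rewrite /a; lra.
Qed.

(** * Deterministic error bound for approximate least squares *)

(* If [D = 0] then [xh = x0] and division by zero makes the normalized direction
   zero, so the bound remains correct. *)
Lemma least_squares_error_bound (R : rcfType) (I : finType)
    (x e xh x0 : I -> R) (delta : R) :
  let D := Num.sqrt (\sum_i (xh i - x0 i) ^+ 2) in
  0 <= delta -> \sum_i (x i - x0 i) ^+ 2 <= delta ^+ 2 ->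
  \sum_i (x i + e i - xh i) ^+ 2
    <= \sum_i (x i + e i - x0 i) ^+ 2 + delta ^+ 2 ->
  Num.sqrt (\sum_i (x i - xh i) ^+ 2)
    <= 2 * delta + 4 * Num.max (\sum_i (xh i - x0 i) / D * e i) 0.
Proof.
move=> D d0 x0d hmin.
set r := Num.sqrt _; set z := Num.max _ _.
have r0 : 0 <= r by exact: sqrtr_ge0.
have z0 : 0 <= z by rewrite le_max lexx orbT.
have D0 : 0 <= D by exact: sqrtr_ge0.
have s0 (f : I -> R) : 0 <= \sum_i f i ^+ 2 by apply: sumr_ge0 => i _; exact: sqr_ge0.
have r2 : r ^+ 2 = \sum_i (x i - xh i) ^+ 2 by rewrite sqr_sqrtr.
have D2 : D ^+ 2 = \sum_i (xh i - x0 i) ^+ 2 by rewrite sqr_sqrtr.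
(* The last bracket is the difference of the two criteria, at most [delta ^+ 2] by hypothesis. *)
have expand : r ^+ 2 = 2 * \sum_i (xh i - x0 i) * e i
    + \sum_i (x i - x0 i) ^+ 2
    + (\sum_i (x i + e i - xh i) ^+ 2 - \sum_i (x i + e i - x0 i) ^+ 2).
  rewrite r2 mulr_sumr -sumrB -!big_split/=.
  by apply: eq_bigr => i _; ring.
have DE : \sum_i (xh i - x0 i) * e i = D * \sum_i (xh i - x0 i) / D * e i.
  have [D00|D00] := eqVneq D 0; last first.
    by rewrite mulr_sumr; apply: eq_bigr => i _; field.
  rewrite D00 mul0r big1// => i _.
  move: D2; rewrite D00 expr0n/= => /esym/psumr_eq0P => /(_ (fun i _ => sqr_ge0 _)).
  by move=> /(_ i isT)/eqP; rewrite sqrf_eq0 => /eqP->; rewrite mul0r.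
(* Triangle inequality through [x], proved in squared form with the parallelogram identity. *)
have Dle : D <= 2 * (r + delta).
  rewrite -(ler_pXn2r (_ : 0 < 2)%N)// ?nnegrE//; last by lra.
  apply: (@le_trans _ _ (2 * r ^+ 2 + 2 * delta ^+ 2)); last by nra.
  apply: (@le_trans _ _ (2 * r ^+ 2 + 2 * \sum_i (x i - x0 i) ^+ 2)); last by lra.
  rewrite D2 r2 !mulr_sumr -big_split/=.
  apply: ler_sum => i _; rewrite -subr_ge0.
  by rewrite (_ : _ - _ = (x i - xh i + (x i - x0 i)) ^+ 2) ?sqr_ge0//; ring.
have Dz : D * \sum_i (xh i - x0 i) / D * e i <= 2 * (r + delta) * z.
  apply: (@le_trans _ _ (D * z)); last by rewrite ler_wpM2r.
  by rewrite ler_wpM2l// le_max lexx.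
(* If [r] exceeded [2 * delta + 4 * z], multiplying by [r] would contradict the quadratic bound that
   follows. *)
rewrite leNgt; apply/negP => hr.
have : r ^+ 2 <= 4 * (r + delta) * z + 2 * delta ^+ 2 by rewrite expand DE; lra.
apply/negP; rewrite -ltNge; nra.
Qed.

(** * Permutation action, Robinson loss and least-squares criterion *)

Lemma mxact_perm (R : realType) (n : nat) (s : 'S_n) (M : 'M[R]_n) :
  mxact (perm_mx s) M = \matrix_(i, j) M (s i) (s j).
Proof.
rewrite /mxact tr_perm_mx -row_permE -col_permE; apply/matrixP => i j.
by rewrite !mxE.
Qed.

(** Reindexing moves the permutation from the data to the fitted matrix, so that all fits are
    compared with the same data, over the index set of the noise. *)
Lemma frobenius_perm (R : realType) (n : nat) (s : 'S_n) (M T : 'M[R]_n) :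
  frobenius_norm (mxact (perm_mx s) M - T)
  = Num.sqrt (\sum_(p : 'I_n * 'I_n)
      (M p.1 p.2 - T (s^-1 p.1)%g (s^-1 p.2)%g) ^+ 2).
Proof.
rewrite /frobenius_norm mxact_perm; congr Num.sqrt.
rewrite -(pair_bigA _ (fun i j => (M i j - T (s^-1 i)%g (s^-1 j)%g) ^+ 2))/=.
rewrite [RHS](reindex_inj (@perm_inj _ s)).
apply: eq_bigr => i _; rewrite [RHS](reindex_inj (@perm_inj _ s)).
by apply: eq_bigr => j _; rewrite !mxE !permK.
Qed.

Lemma frobenius_norm_ge0 (R : realType) (m n : nat) (M : 'M[R]_(m, n)) :
  0 <= frobenius_norm M.
Proof. exact: sqrtr_ge0. Qed.

Lemma toeplitz_robinson (R : realType) (n : nat) (theta : 'rV[R]_n) :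
  nonincreasing_vec theta -> robinson (toeplitz theta).
Proof.
move=> ni; split => [|i].
  apply/matrixP => i j; rewrite !mxE; congr (theta 0 _).
  by apply: val_inj; rewrite /= distnC.
by split => j k jk ki; rewrite !mxE; apply: ni => /=; lia.
Qed.

Lemma l2_loss_ge0 (R : realType) (n : nat) (X Pi : 'M[R]_n) :
  0 <= l2_loss X Pi.
Proof.
apply: lb_le_inf.
  exists (frobenius_norm (mxact Pi X - 0)), 0 => //.
  by split => [|i]; [rewrite trmx0|split => j k _ _; rewrite !mxE].
by move=> _ [M _ <-]; exact: frobenius_norm_ge0.
Qed.

Lemma l2_loss_le (R : realType) (n : nat) (X Pi M : 'M[R]_n) :
  robinson M -> l2_loss X Pi <= frobenius_norm (mxact Pi X - M).
Proof.
move=> rM; apply: ge_inf; last by exists M.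
by exists 0 => _ [? _ <-]; exact: frobenius_norm_ge0.
Qed.

(** The criterion is an infimum, so a fitted vector is chosen within [eps] of it; this slack
    replaces attainment. *)
Lemma ls_minimizer_approx (R : realType) (n : nat) (A eps : R)
    (Y Pi Pi' : 'M[R]_n) (theta' : 'rV[R]_n) :
  ls_minimizer A Y Pi -> is_perm_mx Pi' -> 0 < eps ->
  (forall i, grid n A (theta' 0 i)) -> nonincreasing_vec theta' ->
  exists theta : 'rV[R]_n, [/\ forall i, grid n A (theta 0 i),
    nonincreasing_vec theta &
    frobenius_norm (mxact Pi Y - toeplitz theta) ^+ 2
      <= frobenius_norm (mxact Pi' Y - toeplitz theta') ^+ 2 + eps].
Proof.
move=> [_ minPi] pPi' eps0 gt' nt'.
pose S Q := [set frobenius_norm (mxact Q Y - toeplitz theta) ^+ 2 | theta in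
  [set theta : 'rV[R]_n | (forall i, grid n A (theta 0 i))
                          /\ nonincreasing_vec theta]].
have infS Q : has_inf (S Q).
  split; first by eexists; exists theta'.
  by exists 0 => _ [t _ <-]; exact: sqr_ge0.
have [_ [t [gt nt] <-] lt] := inf_adherent eps0 (infS Pi).
exists t; split => //; apply: (le_trans (ltW lt)); rewrite lerD2r.
apply: (le_trans (minPi _ pPi')).
by apply: ge_inf; [case: (infS Pi')|exists theta'].
Qed.

(** * Rounding to the grid and counting the candidate fits *)

Definition grid_round (R : realType) (n : nat) (x : R) : R :=
  (n%:R ^+ 2)^-1 * (Num.truncn (n%:R ^+ 2 * x))%:R.

Lemma grid_round_le (R : realType) (n : nat) (x y : R) :
  x <= y -> grid_round n x <= grid_round n y.
Proof.
move=> xy; rewrite ler_wpM2l ?invr_ge0 ?sqr_ge0// ler_nat.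
by apply: le_truncn; rewrite ler_wpM2l ?sqr_ge0.
Qed.

Lemma grid_roundP (R : realType) (n : nat) (x : R) : (0 < n)%N -> 0 <= x ->
  x - (n%:R ^+ 2)^-1 <= grid_round n x <= x.
Proof.
move=> n0 x0; have n2 : 0 < (n%:R : R) ^+ 2 by rewrite exprn_gt0// ltr0n.
have y0 : 0 <= n%:R ^+ 2 * x by rewrite mulr_ge0// ltW.
have /andP[h1 h2] := truncn_itv y0.
rewrite /grid_round ler_pdivrMl// h1 andbT -(ler_pM2l n2) mulrBr.
rewrite divff ?gt_eqF// mulVKf ?gt_eqF//.
by move: h2; rewrite -natr1; lra.
Qed.

Lemma grid_round_grid (R : realType) (n : nat) (A x : R) : (0 < n)%N ->
  0 <= x <= A -> grid n A (grid_round n x).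
Proof.
move=> n0 /andP[x0 xA]; have /andP[_ h] := grid_roundP n0 x0.
split; last by exists (Num.truncn (n%:R ^+ 2 * x)).
by rewrite (le_trans h xA) andbT mulr_ge0// invr_ge0 sqr_ge0.
Qed.

(** At most [n ^ n] permutations, and at most [(n * A) ^ 3] grid values for each of [n] coordinates.
    A second factor [n ^ n], at least 2, absorbs the leading 1, whence the exponent [5 * n]. *)
Lemma card_perm_grid_le (R : realType) (n : nat) (A : R) : (2 <= n)%N -> 1 <= A ->
  1 + #|{: 'S_n * {ffun 'I_n -> 'I_(Num.truncn (n%:R ^+ 2 * A)).+1}}|%:R
    <= expR (5 * (n%:R * ln (n%:R * A))).
Proof.
move=> n2 A1; set K := Num.truncn _.
have nR : 2 <= n%:R :> R by rewrite (ler_nat _ 2).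
have nA0 : 0 < n%:R * A by rewrite mulr_gt0; lra.
(* As [n * A >= 2], one more factor [n * A] pays for the added 1. *)
have K1 : K.+1%:R <= (n%:R * A) ^+ 3 :> R.
  have : K%:R <= n%:R ^+ 2 * A :> R by rewrite truncn_le mulr_ge0// ?sqr_ge0; lra.
  have m2 : 2 <= n%:R * A by nra.
  have n2A : n%:R ^+ 2 * A <= (n%:R * A) ^+ 2.
    by rewrite exprMn ler_wpM2l ?sqr_ge0// expr2; nra.
  rewrite -natr1 [_ ^+ 3]exprS.
  have : 2 * (n%:R * A) ^+ 2 <= n%:R * A * (n%:R * A) ^+ 2.
    by rewrite ler_wpM2r// sqr_ge0.
  have : 1 <= (n%:R * A) ^+ 2 by rewrite -[leLHS](expr1n _ 2) lerXn2r ?nnegrE; lra.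
  lra.
rewrite card_prod card_Sn card_ffun !card_ord.
have -> : expR (5 * (n%:R * ln (n%:R * A))) = ((n%:R * A) ^+ 5) ^+ n.
  by rewrite mulrCA expRM_natl (expRM_natl 5) lnK.
apply: (@le_trans _ _ (n ^ n * (n ^ n * K.+1 ^ n))%:R).
  rewrite -(natrD _ 1%N) ler_nat.
  have f0 : (n`! <= n ^ n)%N.
    have -> : (n ^ n = \prod_(1 <= i < n.+1) n)%N.
      by rewrite prod_nat_const_nat subn1.
    rewrite fact_prod !big_nat; apply: leq_prod => i /andP[_]; rewrite ltnS//.
  have N2 : (2 <= n ^ n)%N by rewrite (leq_trans n2)// -[leqLHS]expn1 leq_pexp2l; lia.
  have b0 : (0 < K.+1 ^ n)%N by rewrite expn_gt0.
  apply: (@leq_trans (2 * (n ^ n * K.+1 ^ n))); last by rewrite leq_mul2r N2 orbT.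
  by rewrite mul2n -addnn leq_add ?leq_mul2r ?f0 ?orbT// muln_gt0 b0 (ltnW N2).
rewrite -!expnMn natrX; apply: lerXn2r; rewrite ?nnegrE ?ler0n ?exprn_ge0 ?(ltW nA0)//.
rewrite !natrM [leRHS](exprD _ 2 3) mulrA ler_pM ?mulr_ge0 ?ler0n//.
by rewrite -expr2 lerXn2r ?nnegrE//; nra.
Qed.

Lemma n_ln_nA_ge1 (R : realType) (n : nat) (A : R) : (2 <= n)%N -> 1 <= A ->
  1 <= n%:R * ln (n%:R * A).
Proof.
move=> n2 A1; have nR : 2 <= n%:R :> R by rewrite (ler_nat _ 2).
have l2 : 2^-1 <= ln (n%:R * A).
  apply: (@le_trans _ _ (ln 2)); last by rewrite ler_ln ?posrE; nra.
  rewrite -[leLHS]expRK ler_ln ?posrE ?expR_gt0//.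
  (* From [expR (- 1 / 2) >= 1 / 2] follows [expR (1 / 2) <= 2], that is [ln 2 >= 1 / 2]. *)
  have := expR_ge1Dx (- (2^-1) : R); rewrite expRN => h.
  have := expR_gt0 (2^-1 : R) => e0.
  rewrite -lef_pV2 ?posrE//; lra.
nra.
Qed.

(** * Measurability of the loss and discretization of the fits *)

(** [Pi] takes finitely many values, so a preimage is a finite union of events fixing every entry.
    This handles [l2_loss], an infimum over an uncountable set. *)
Lemma measurable_fun_perm_mx (R : realType) (n : nat) (d : measure_display)
    (Omega : measurableType d) (Pi : Omega -> 'M[R]_n) (F : 'M[R]_n -> R) :
  (forall w, is_perm_mx (Pi w)) ->
  (forall i j, measurable_fun [set: Omega] (fun w => Pi w i j)) ->
  measurable_fun [set: Omega] (fun w => F (Pi w)).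
Proof.
move=> pPi mPi _ B mB; rewrite setTI.
rewrite (_ : _ @^-1` _ = \bigcup_(s in [set s : 'S_n | B (F (perm_mx s))])
    \bigcap_(p in [set: 'I_n * 'I_n])
      ((fun w => Pi w p.1 p.2) @^-1` [set (perm_mx s : 'M[R]_n) p.1 p.2])).
  apply: fin_bigcup_measurable => [|s _]; first exact: finite_finset.
  apply: fin_bigcap_measurable => [|p _]; first exact: finite_finset.
  by rewrite -[X in measurable X]setTI; apply: mPi => //; exact: measurable_set1.
apply/seteqP; split => [w /= Bw|w /= [s Bs h]].
  have /is_perm_mxP[s sE] := pPi w.
  by exists s => /=; rewrite -?sE// => p _ /=; rewrite sE.
suff -> : Pi w = perm_mx s by [].
by apply/matrixP => i j; exact: (h (i, j)).
Qed.

Lemma grid_ord (R : realType) (n : nat) (A x : R) : (0 < n)%N -> grid n A x ->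
  exists k : 'I_(Num.truncn (n%:R ^+ 2 * A)).+1, x = (n%:R ^+ 2)^-1 * k%:R.
Proof.
move=> n0 [/andP[x0 xA] [k xk]].
have n2 : 0 < (n%:R : R) ^+ 2 by rewrite exprn_gt0// ltr0n.
have kK : (k < (Num.truncn (n%:R ^+ 2 * A)).+1)%N.
  rewrite ltnS truncn_ge_nat; last by rewrite mulr_ge0 ?(ltW n2)// (le_trans x0).
  by rewrite -ler_pdivrMl// -xk.
by exists (Ordinal kK).
Qed.

Lemma toeplitz_dist_le (R : realType) (n : nat) (theta theta' : 'rV[R]_n)
    (s : 'S_n) (eps : R) :
  (forall i, `|theta 0 i - theta' 0 i| <= eps) ->
  \sum_(p : 'I_n * 'I_n) (toeplitz theta (s p.1) (s p.2)
    - toeplitz theta' (s p.1) (s p.2)) ^+ 2 <= (n%:R * eps) ^+ 2.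
Proof.
move=> h; apply: (@le_trans _ _ (\sum_(p : 'I_n * 'I_n) eps ^+ 2)).
  apply: ler_sum => p _; rewrite !mxE -real_normK ?num_real//.
  by rewrite lerXn2r ?nnegrE// (le_trans _ (h (dist_ord (s p.1) (s p.2)))).
by rewrite sumr_const card_prod !card_ord -[leLHS]mulr_natl natrM exprMn.
Qed.

(** * Risk bound for the least-squares permutation *)

Theorem theorem11 (R : realType) :
  exists C : R, 0 < C /\
  forall (n : nat) (A : R) (theta : 'rV[R]_n) (Pistar : 'M[R]_n)
    (d : measure_display) (Omega : measurableType d) (P : probability Omega R)
    (E : 'I_n * 'I_n -> {RV P >-> R}) (Pihat : Omega -> 'M[R]_n),
  (2 <= n)%N -> 1 <= A ->
  (forall i, 0 <= theta 0 i <= A) -> nonincreasing_vec theta ->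
  is_perm_mx Pistar ->
  mutually_independent E -> (forall ij, standard_normal (E ij)) ->
  let X := mxact Pistar (toeplitz theta) in
  let Y := fun w : Omega => X + \matrix_(i, j) E (i, j) w in
  (forall w, ls_minimizer A (Y w) (Pihat w)) ->
  (forall i j, measurable_fun [set: Omega] (fun w => Pihat w i j)) ->
  ('E_P[fun w => l2_loss X (Pihat w)]
     <= (C * (Num.sqrt (n%:R * ln (n%:R * A)) + A / n%:R))%:E)%E.
Proof.
(* The value is [3 * 4 * 3]: 3 from the maximal inequality, 4 from the error bound, and 3 as an
   upper bound for the square root of 5. *)
exists 36; split => // n A theta Pistar d Omega P E Pihat n2 A1 thA nth.
move=> /is_perm_mxP[t ->{Pistar}] iE nE X Y minPi mPi.
have n0 : (0 < n)%N by exact: ltnW.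
have nR : 0 < n%:R :> R by rewrite ltr0n.
pose theta0 : 'rV[R]_n := \row_i grid_round n (theta 0 i).
have th0A i : grid n A (theta0 0 i) by rewrite mxE; exact: grid_round_grid.
have nth0 : nonincreasing_vec theta0.
  by move=> i j ij; rewrite !mxE; exact/grid_round_le/nth.
pose delta : R := n%:R^-1.
have delta0 : 0 < delta by rewrite invr_gt0.
(* A deterministic index set: the noise selects an element but does not alter the family. Grid
   points are coded by their numerators. *)
pose J : finType := ('S_n * {ffun 'I_n -> 'I_(Num.truncn (n%:R ^+ 2 * A)).+1})%type.
pose xh (j : J) (p : 'I_n * 'I_n) : R :=
  (n%:R ^+ 2)^-1 * (j.2 (dist_ord (j.1 p.1) (j.1 p.2)))%:R.
pose x0 (p : 'I_n * 'I_n) := toeplitz theta0 (t p.1) (t p.2).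
pose D j := Num.sqrt (\sum_p (xh j p - x0 p) ^+ 2).
pose u j p := (xh j p - x0 p) / D j.
have XE p : X p.1 p.2 = toeplitz theta (t p.1) (t p.2).
  by rewrite /X mxact_perm mxE.
have Xx0 : \sum_p (X p.1 p.2 - x0 p) ^+ 2 <= delta ^+ 2.
  under eq_bigr do rewrite XE.
  (* An entrywise rounding error of [n ^ -2] costs a factor [n] in Frobenius norm, which gives
     [delta]. *)
  apply: le_trans (toeplitz_dist_le t (eps := (n%:R ^+ 2)^-1) _) _.
    move=> i; rewrite mxE; have /andP[] := grid_roundP n0 (andP (thA i)).1.
    by move=> h1 h2; rewrite ger0_norm; lra.
  by rewrite expr2 invfM mulVKf// gt_eqF.
have u1 j : \sum_p u j p ^+ 2 <= 1.
  have S0 : 0 <= \sum_p (xh j p - x0 p) ^+ 2.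
    by apply: sumr_ge0 => p _; exact: sqr_ge0.
  under eq_bigr do rewrite expr_div_n.
  rewrite -mulr_suml sqr_sqrtr//.
  by have [->|?] := eqVneq (\sum_p (xh j p - x0 p) ^+ 2) 0; rewrite ?mul0r ?divff.
have L1 := n_ln_nA_ge1 n2 A1.
have bound w : exists j,
    l2_loss X (Pihat w) <= 2 * delta + 4 * Num.max (\sum_p u j p * E p w) 0.
  have [/is_perm_mxP[s sE] _] := minPi w.
  (* The competitor [t^-1] undoes the true permutation; the slack [delta ^+ 2] matches
     [least_squares_error_bound]. *)
  have [|theta1 [th1A nth1 le1]] := ls_minimizer_approx (minPi w)
    (perm_mx_is_perm _ (t^-1)%g) (_ : 0 < delta ^+ 2) th0A nth0.
    by rewrite exprn_gt0.
  have /choice[k kE] i : exists k : 'I_(Num.truncn (n%:R ^+ 2 * A)).+1,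
      theta1 0 i = (n%:R ^+ 2)^-1 * k%:R by exact: grid_ord.
  exists ((s^-1)%g, [ffun i => k i]); set j := (_, _).
  have xhE p : xh j p = toeplitz theta1 (s^-1 p.1)%g (s^-1 p.2)%g.
    by rewrite /xh ffunE mxE kE.
  apply: (le_trans (l2_loss_le _ _ (toeplitz_robinson nth1))).
  rewrite sE frobenius_perm; under eq_bigr do rewrite -xhE.
  apply: least_squares_error_bound => //; first exact: ltW.
  have sq (f : 'I_n * 'I_n -> R) : Num.sqrt (\sum_p f p ^+ 2) ^+ 2 = \sum_p f p ^+ 2.
    by rewrite sqr_sqrtr// sumr_ge0// => p _; exact: sqr_ge0.
  move: le1; rewrite sE !frobenius_perm !sq invgK.
  have YE p : Y w p.1 p.2 = X p.1 p.2 + E p w.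
    by rewrite /Y mxE [X in _ + X]mxE -surjective_pairing.
  by under eq_bigr do rewrite -xhE YE; under [X in _ <= X + _ -> _]eq_bigr do rewrite YE.
rewrite unlock.
apply: le_trans (gaussian_maximal_inequality (l := 5 * (n%:R * ln (n%:R * A)))
  iE nE u1 _ (card_perm_grid_le n2 A1) _ _ _ _ bound) _ => //.
- by lra.
- by lra.
- apply: (@measurable_fun_perm_mx _ _ _ _ _ (l2_loss X)) => // w.
  by case: (minPi w).
- by move=> w; exact: l2_loss_ge0.
rewrite lee_fin.
set L := _ * ln _ in L1 *.
have dA : delta <= A / n%:R by rewrite -[leLHS]mul1r ler_pM2r ?invr_gt0.
have s5 : Num.sqrt (5 * L) <= 3 * Num.sqrt L.
  rewrite sqrtrM// ler_wpM2r ?sqrtr_ge0// -[leRHS]ger0_norm// -sqrtr_sqr.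
  by rewrite ler_wsqrtr//; lra.
have := sqrtr_ge0 L; lra.
Qed.
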